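(* Consider the Polish Algorithm for right duplication $abc{*}{*} = ab{*}cc{*}{*}$ (that is, $a(bc)=(ab)(cc)$). It terminates for every pair of terms $u,v\in\mathbf{T}$ with $\mathrm{depth}(u)\le 6$ and $\mathrm{depth}(v)\le 6$. There exist pairs of terms $u,v\in\mathbf{T}$ with $\mathrm{depth}(u)\le 7$ and $\mathrm{depth}(v)\le 7$ for which it diverges (i.e. never terminates).
   Context: Terms. $\mathbf{T}$ is the set of terms in one variable $x$ and one binary operation symbol $*$ in right Polish notation: it is the smallest set of finite words over the alphabet $\{x,*\}$ with $x \in \mathbf{T}$ and $st* \in \mathbf{T}$ whenever $s,t\in\mathbf{T}$ (the word $st*$ represents the product $s\cdot t$). The depth of a term is its number of occurrences of $x$. A term $v$ is viewed as a word $v(0)v(1)\cdots v(n-1)$ with $n=\mathrm{length}(v)$. First difference. For $u,v\in\mathbf{T}$, $d(u,v)$ is the least $i<\min(\mathrm{length}(u),\mathrm{length}(v))$ with $u(i)\ne v(i)$ if such an $i$ exists, and $d(u,v)=\infty$ otherwise. Dynamic range. Let $d=d(u,v)<\infty$ and $v(d)=*$ (so $u(d)=x$). Then $u$ and $v$ can be written uniquely as $$u = A\,u_0\,u_1\,u_2 * u_3 * \cdots u_n * *\, B,\qquad v = A\,u_0\,u_1 *\, C,$$ where $n\ge 2$, $u_0,\dots,u_n\in\mathbf{T}$, $A,B,C$ are strings, and the first letter of $u_2$ is at position $d$ in $u$ (so the displayed subterm of $u$ is $u_0\cdot((\cdots((u_1\cdot u_2)\cdot u_3)\cdots)\cdot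 u_n)$). Polish Algorithm for right duplication. Given $(u,v)$, stop if $d(u,v)=\infty$. Otherwise let $d=d(u,v)$. If $v(d)=*$, put $v'=v$ and, with the notation above, $$u' = A\,u_0\,u_1 *\, u_2\,u_2 **\, u_3\,u_3 ** \cdots u_n\,u_n **\, B .$$ If $u(d)=*$, put $u'=u$ and define $v'$ analogously with the roles of $u$ and $v$ exchanged. Passing from $(u,v)$ to $(u',v')$ is one step. The algorithm repeats steps; it terminates on $(u,v)$ if after finitely many steps it reaches a pair $(u^*,v^* )$ with $d(u^*,v^* )=\infty$, and diverges otherwise. *)

(* Defs.v *)
From Stdlib Require Export Relation_Operators.
From HB Require Import structures.
From mathcomp Require Export all_boot.

Set Implicit Arguments.
Unset Strict Implicit.
Unset Printing Implicit Defensive.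

Inductive letter : Set := X | Star.

Definition letter_eqb (a b : letter) : bool :=
  match a, b with
  | X, X | Star, Star => true
  | _, _ => false
  end.

Lemma letter_eqP : Equality.axiom letter_eqb.
Proof. by case; case; constructor. Qed.

HB.instance Definition _ := hasDecEq.Build letter letter_eqP.

Definition word : Type := seq letter.

(* Terms are words in right Polish notation: [s ++ t ++ [:: Star]] is s * t. *)
Inductive is_term : word -> Prop :=
| is_term_var : is_term [:: X]
| is_term_mul (s t : word) :
    is_term s -> is_term t -> is_term (s ++ t ++ [:: Star]).

Definition depth (u : word) : nat := count_mem X u.

(* [None] stands for infinity. *)
Definition first_diff (u v : word) : option nat :=
  ohead [seq i <- iota 0 (minn (size u) (size v)) | nth X u i != nth X v i].

(* One right-duplication expansion of [u] against [v], in the case v(d) = Star.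
   The list [us] is u_2, ..., u_n, nonempty because n >= 2; the condition
   [size (A ++ u0 ++ u1) = d] puts the first letter of u_2 at position d. *)
Definition expands (u v u' : word) : Prop :=
  exists (d : nat) (A B C u0 u1 : word) (us : seq word),
    (first_diff u v = Some d /\ nth X v d = Star) /\
    (is_term u0 /\ is_term u1 /\ us <> [::] /\
       (forall t, t \in us -> is_term t)) /\
    size (A ++ u0 ++ u1) = d /\
    u = A ++ u0 ++ u1 ++ flatten [seq t ++ [:: Star] | t <- us]
          ++ [:: Star] ++ B /\
    v = A ++ u0 ++ u1 ++ [:: Star] ++ C /\
    u' = A ++ u0 ++ u1 ++ [:: Star]
           ++ flatten [seq t ++ t ++ [:: Star; Star] | t <- us] ++ B.

Definition polish_step (p q : word * word) : Prop :=
  (expands p.1 p.2 q.1 /\ q.2 = p.2) \/ (expands p.2 p.1 q.2 /\ q.1 = p.1).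

Definition terminates (u v : word) : Prop :=
  exists us vs : word,
    clos_refl_trans (word * word) polish_step (u, v) (us, vs) /\
    first_diff us vs = None.

(* On terms the decomposition in [expands] exists and is unique, so
   [polish_step] is deterministic and gets stuck only when the first
   difference is infinite. *)
Definition diverges (u v : word) : Prop := ~ terminates u v.

(* Main.v *)
Require Import Defs.

(** Reading a common prefix of the two terms on a stack of completed subterms
    gives [A ++ u0 ++ u1] as the whole stack with [u1], [u0] on top, and reading
    on from the first difference gives [u_2, ..., u_n].  One step of the
    algorithm is therefore computable and deterministic.  Termination in depth
    at most 6 is a finite computation.  For divergence in depth 7, two steps
    lead from [xx*xx*xx*x***], [xxx*x*xx*x***] to a pair [P ++ a], [P ++ b] with
    [a = x*xx*x***] and [b = *xx*x*xx*x***], and one step takes [P ++ a],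
    [P ++ b] to [Q ++ b], [Q ++ a] where [Q = P ++ *xx*]. *)

(** * Stack reading of right Polish words *)

Definition all_terms (st : seq word) : Prop := forall t, t \in st -> is_term t.

Lemma all_terms_cons t st :
  all_terms (t :: st) <-> is_term t /\ all_terms st.
Proof.
split=> [H|[Ht Hst] s]; last by rewrite inE => /orP [/eqP ->|/Hst].
by split=> [|s Hs]; apply: H; rewrite inE ?eqxx ?Hs ?orbT.
Qed.

Lemma all_terms_nil : all_terms [::].
Proof. by []. Qed.

(* The stack lists the most recent subterm first. *)
Definition shift (st : seq word) (a : letter) : option (seq word) :=
  match a, st with
  | X, _ => Some ([:: X] :: st)
  | Star, t :: s :: st' => Some ((s ++ t ++ [:: Star]) :: st')
  | Star, _ => None
  end.

Lemma shift_all_terms st a st' :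
  shift st a = Some st' -> all_terms st -> all_terms st'.
Proof.
case: a st => [|] st /=; last case: st => [|t [|s st]] //.
  by case=> <- H; apply/all_terms_cons; split=> //; exact: is_term_var.
case=> <- /all_terms_cons [Ht /all_terms_cons [Hs Hst]].
by apply/all_terms_cons; split=> //; exact: is_term_mul.
Qed.

Lemma shift_flatten st a st' :
  shift st a = Some st' -> flatten (rev st') = flatten (rev st) ++ [:: a].
Proof.
case: a st => [|] st /=; last case: st => [|t [|s st]] //.
  by case=> <-; rewrite rev_cons flatten_rcons.
by case=> <-; rewrite !rev_cons !flatten_rcons -!catA.
Qed.

Definition with_star (us : seq word) : word :=
  flatten [seq t ++ [:: Star] | t <- us].

Definition duplicate (us : seq word) : word :=
  flatten [seq t ++ t ++ [:: Star; Star] | t <- us].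

(* Splits [r] as [with_star us ++ Star :: B]. *)
Fixpoint scan (st : seq word) (r : word) : option (seq word * word) :=
  if r is a :: r' then
    if shift st a is Some st' then scan st' r' else
    if st is t :: _ then omap (fun p => (t :: p.1, p.2)) (scan [::] r')
    else Some ([::], r')
  else None.

(** A star rejected by [shift] meets at most one completed term: with one, it closes the next entry
    of [us]; with none, it is the final star, and what follows is [B]. *)
Lemma scan_sound st r us B :
  all_terms st -> scan st r = Some (us, B) ->
  all_terms us /\ flatten (rev st) ++ r = with_star us ++ Star :: B.
Proof.
elim: r st us B => [//|a r IH] st us B Hst /=.
case E: (shift st a) => [st'|].
  case/(IH _ _ _ (shift_all_terms _ _ _ E Hst)) => Hus Eus; split=> //.
  by rewrite -Eus (shift_flatten _ _ _ E) -catA.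
case: a E => //; case: st Hst => [|t [|s st]] //= Hst _; first by case=> <- <-.
case Er: (scan [::] r) => [[us' B']|] //= [<- <-].
have [Hus' /= Eus'] := IH _ _ _ all_terms_nil Er.
by split; [apply/all_terms_cons; case/all_terms_cons: Hst
          | rewrite Eus' /with_star /= cats0 -!catA].
Qed.

Lemma scan_term t st r : is_term t -> scan st (t ++ r) = scan (t :: st) r.
Proof.
move=> Ht; elim: Ht st r => {t} [//|s t _ IHs _ IHt] st r.
by rewrite -!catA IHs IHt.
Qed.

(** Completeness of [scan], whence the uniqueness of [u_2, ..., u_n] and [B]. *)
Lemma scan_with_star us B :
  all_terms us -> scan [::] (with_star us ++ Star :: B) = Some (us, B).
Proof.
elim: us => [//|t us IH] /all_terms_cons [Ht Hus].
by rewrite /with_star /= -!catA scan_term //= IH.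
Qed.

(** * First differences *)

Lemma first_diff_cons a b u v :
  first_diff (a :: u) (b :: v) =
  if a != b then Some 0 else omap succn (first_diff u v).
Proof.
rewrite /first_diff /= minnSS /=; case: eqP => //= _.
rewrite -[1]addn0 iotaDl filter_map /=.
rewrite (eq_filter (a2 := fun i => nth X u i != nth X v i)) //.
by case: filter.
Qed.

Lemma first_diff_prefix P a b u v :
  a != b -> first_diff (P ++ a :: u) (P ++ b :: v) = Some (size P).
Proof.
move=> neq; elim: P => [|c P IH] /=; first by rewrite first_diff_cons neq.
by rewrite first_diff_cons eqxx IH.
Qed.

Lemma first_diff_catr P v : first_diff P (P ++ v) = None.
Proof.
elim: P => [|c P IH] /=; first by rewrite /first_diff min0n.
by rewrite first_diff_cons eqxx IH.
Qed.

Lemma first_diff_sym u v : first_diff u v = first_diff v u.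
Proof.
by rewrite /first_diff minnC; congr ohead; apply: eq_filter => i; rewrite eq_sym.
Qed.

(** * Steps of the algorithm: symmetry, determinism, execution *)

Lemma polish_step_swap u v q :
  polish_step (u, v) q -> polish_step (v, u) (q.2, q.1).
Proof. by case; [right | left]. Qed.

Lemma terminates_step u v u' v' :
  polish_step (u, v) (u', v') -> terminates u' v' -> terminates u v.
Proof.
move=> Hs [us [vs [Hr Hd]]]; exists us, vs; split=> //.
exact: rt_trans (rt_step _ _ _ _ Hs) Hr.
Qed.

Lemma terminates_sym u v : terminates u v -> terminates v u.
Proof.
case=> us [vs [Hr Hd]]; exists vs, us; rewrite first_diff_sym; split=> //.
have swap p q : clos_refl_trans _ polish_step p q ->
    clos_refl_trans _ polish_step (p.2, p.1) (q.2, q.1).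
  elim=> {p q} [[? ?] q Hs|p|p q r _ Hpq _ Hqr].
  - exact/rt_step/polish_step_swap.
  - exact: rt_refl.
  - exact: rt_trans Hpq Hqr.
exact: (swap _ _ Hr).
Qed.

Lemma expand_step u1 u0 st u v t us B :
  let P := flatten (rev [:: u1, u0 & st]) in
  all_terms [:: u1, u0 & st] -> scan [::] (X :: u) = Some (t :: us, B) ->
  polish_step (P ++ X :: u, P ++ Star :: v)
              (P ++ Star :: duplicate (t :: us) ++ B, P ++ Star :: v).
Proof.
move=> P /all_terms_cons [Hu1 /all_terms_cons [Hu0 _]].
case/(scan_sound _ _ _ _ all_terms_nil) => Hus Eu.
have EP : P = flatten (rev st) ++ u0 ++ u1.
  by rewrite /P !rev_cons !flatten_rcons catA.
left; split=> //=; exists (size P), (flatten (rev st)), B, v, u0, u1, (t :: us).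
split; first by rewrite first_diff_prefix // nth_cat ltnn subnn.
split=> //; split; first by rewrite EP.
rewrite -[X :: u]/(flatten (rev [::]) ++ X :: u) Eu EP -!catA.
by do !split.
Qed.

(** Determinism. The position of the first difference forces [A ++ u0 ++ u1 = P], and the result
    depends on [A], [u0], [u1] only through this word; [scan_with_star] fixes the rest. *)
Lemma polish_step_inv P u v us B q :
  polish_step (P ++ X :: u, P ++ Star :: v) q ->
  scan [::] (X :: u) = Some (us, B) ->
  q = (P ++ Star :: duplicate us ++ B, P ++ Star :: v).
Proof.
move=> Hstep Hscan; case: Hstep => [[/= [d H] Eq2]|[/= [d H] _]]; last first.
  (* Expanding the second word would need a star at the first difference in the first word, which
     has [X] there. *)
  move: H => [A [B' [C [u0 [u1 [us' [[Hd Hn] _]]]]]]]; move: Hd Hn.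
  by rewrite first_diff_prefix // => -[<-]; rewrite nth_cat ltnn subnn.
move: H => [A [B' [C [u0 [u1 [us' [[Hd _] [[_ [_ [_ Hus']]] [Hsz [Eu [_ Eu']]]]]]]]]]].
move: Hd; rewrite first_diff_prefix // => -[Ed]; rewrite -{}Ed in Hsz.
have assoc w : A ++ u0 ++ u1 ++ w = (A ++ u0 ++ u1) ++ w by rewrite -!catA.
move: Eu Eu'; rewrite !{}assoc => /eqP; rewrite eqseq_cat // => /andP.
case=> [/eqP <- /eqP Eu] Eu'; move: Hscan.
rewrite Eu (scan_with_star us' B' Hus') => -[<- <-].
by rewrite [q]surjective_pairing Eq2 Eu'.
Qed.

Lemma polish_step_inv_swap P u v us B q :
  polish_step (P ++ Star :: v, P ++ X :: u) q ->
  scan [::] (X :: u) = Some (us, B) ->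
  q = (P ++ Star :: v, P ++ Star :: duplicate us ++ B).
Proof.
move=> /polish_step_swap /polish_step_inv H /H.
by case: q {H} => q1 q2 /= [-> ->].
Qed.

(* Runs the algorithm on a pair with common prefix [flatten (rev st)] and
   remainders [u], [v]; the fuel [n] counts letters read as well as steps. *)
Fixpoint halts (n : nat) (st : seq word) (u v : word) : bool :=
  if n is n'.+1 then
    match u, v with
    | X :: u', X :: v' => halts n' ([:: X] :: st) u' v'
    | Star :: u', Star :: v' =>
        if shift st Star is Some st' then halts n' st' u' v' else false
    | X :: _, Star :: _ =>
        match st, scan [::] u with
        | _ :: _ :: _, Some (t :: us, B) =>
            halts n' st (Star :: duplicate (t :: us) ++ B) v
        | _, _ => false
        end
    | Star :: _, X :: _ =>
        match st, scan [::] v with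
        | _ :: _ :: _, Some (t :: us, B) =>
            halts n' st u (Star :: duplicate (t :: us) ++ B)
        | _, _ => false
        end
    | _, _ => true
    end
  else false.

(** An expansion keeps the common prefix, so reading resumes with the same stack. Lack of fuel
    yields [false], so [true] always witnesses a finished run. *)
Lemma halts_terminates n st u v :
  all_terms st -> halts n st u v ->
  terminates (flatten (rev st) ++ u) (flatten (rev st) ++ v).
Proof.
have stop P w : terminates P (P ++ w).
  by exists P, (P ++ w); split; [exact: rt_refl | exact: first_diff_catr].
elim: n st u v => [//|n IH] st [|a u] [|b v] Hst.
- by rewrite cats0 => _; rewrite -{2}[flatten _]cats0.
- by rewrite cats0.
- by rewrite cats0 => _; apply: terminates_sym.
have read c st' : shift st c = Some st' -> halts n st' u v ->
    terminates (flatten (rev st) ++ c :: u) (flatten (rev st) ++ c :: v).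
  move=> Hc /(IH _ _ _ (shift_all_terms _ _ _ Hc Hst)).
  by rewrite (shift_flatten _ _ _ Hc) -!catA.
case: a b => [|] [|].
- exact: (read X).
- rewrite [halts _ _ _ _]/=.
  case: st Hst {read} => [|u1 [|u0 st]] Hst //.
  case E: (scan [:: [:: X]] u) => [[[|t us] B]|] // H.
  exact: terminates_step (expand_step _ _ _ u _ _ _ _ Hst E) (IH _ _ _ Hst H).
- rewrite [halts _ _ _ _]/=.
  case: st Hst {read} => [|u1 [|u0 st]] Hst //.
  case E: (scan [:: [:: X]] v) => [[[|t us] B]|] // H.
  apply: terminates_sym; apply: terminates_step (expand_step _ _ _ v _ _ _ _ Hst E) _.
  exact: terminates_sym (IH _ _ _ Hst H).
- by case: st Hst read => [|t [|s st]] // _ read; exact: (read Star).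
Qed.

(** * Exhaustive check in depth at most 6 *)

Fixpoint terms_upto (n : nat) : seq word :=
  if n is n'.+1 then
    [:: X] :: [seq w <- [seq s ++ t ++ [:: Star] | s <- terms_upto n',
                                                   t <- terms_upto n']
              | depth w <= n]
  else [::].

Lemma depth_mul s t : depth (s ++ t ++ [:: Star]) = depth s + depth t.
Proof. by rewrite /depth !count_cat /= !addn0. Qed.

Lemma depth_gt0 t : is_term t -> 0 < depth t.
Proof. by elim=> [//|s {}t _ Hs _ _]; rewrite depth_mul addn_gt0 Hs. Qed.

(** Depth is additive and positive on terms, so both factors of a product of depth at most n+1 have
    depth at most n. *)
Lemma mem_terms_upto n t : is_term t -> depth t <= n -> t \in terms_upto n.
Proof.
move=> Ht; elim: Ht n => {t} [|s t Hs IHs Ht IHt] [|n] //.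
  by rewrite depth_mul leqn0 addn_eq0 eqn0Ngt depth_gt0.
move=> Hn; rewrite inE mem_filter Hn /=; apply/orP; right.
move: Hn; rewrite depth_mul => Hn.
apply/allpairsP; exists (s, t) => /=; split=> //.
- by apply: IHs; rewrite -ltnS (leq_trans _ Hn) // -addn1 leq_add2l depth_gt0.
- by apply: IHt; rewrite -ltnS (leq_trans _ Hn) // -add1n leq_add2r depth_gt0.
Qed.

(** The list has 1 + 1 + 2 + 5 + 14 + 42 = 65 entries, giving 4225 ordered pairs; fuel 100 suffices
    for each. *)
Lemma halts_upto6 :
  all (fun u => all (halts 100 [::] u) (terms_upto 6)) (terms_upto 6).
Proof. by vm_compute. Qed.

(** * Divergence in depth 7 *)

Lemma diverges_invariant (I : word * word -> Prop) u v :
  (forall p, I p -> first_diff p.1 p.2 <> None) ->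
  (forall p q, I p -> polish_step p q -> I q) ->
  I (u, v) -> diverges u v.
Proof.
move=> Hdiff Hstep Huv [us [vs [Hr Hd]]].
suff /Hdiff : I (us, vs) by [].
elim: Hr Huv => [p q Hpq Hp|p //|p q r _ Hpq _ Hqr /Hpq/Hqr //].
exact: Hstep Hp Hpq.
Qed.

Definition cycle_x : word := [:: X; Star; X; X; Star; X; Star; Star; Star].

Definition cycle_star : word :=
  [:: Star; X; X; Star; X; Star; X; X; Star; X; Star; Star; Star].

Definition left7 : word :=
  [:: X; X; Star; X; X; Star; X; X; Star; X; Star; Star; Star].

Definition right7 : word :=
  [:: X; X; X; Star; X; Star; X; X; Star; X; Star; Star; Star].

Definition right7_expanded : word := [:: X; X; Star; X; X; Star] ++
  [:: Star; X; X; Star; Star; X; X; Star; X; Star; X; X; Star; X; Star; Star; Star].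

(** With [P] arbitrary, four shapes cover the whole run although the common prefix keeps growing. *)
Inductive orbit7 : word * word -> Prop :=
| orbit7_start : orbit7 (left7, right7)
| orbit7_first : orbit7 (left7, right7_expanded)
| orbit7_cycle P : orbit7 (P ++ cycle_x, P ++ cycle_star)
| orbit7_cycle_swap P : orbit7 (P ++ cycle_star, P ++ cycle_x).

Lemma left7_right7_diverge : diverges left7 right7.
Proof.
apply: (@diverges_invariant orbit7); last exact: orbit7_start.
  by move=> p [|||] // P; rewrite first_diff_prefix.
move=> p q [||P|P].
(* Position 2: [u_2 = u_3 = x], [u_4 = xx*x*], and [B] is empty. *)
- move=> Hq; rewrite (polish_step_inv_swap [:: X; X] _ _ _ _ _ Hq erefl).
  exact: orbit7_first.
(* Position 6: [u_2 = xx*x*] is the only entry. *)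
- move=> Hq; rewrite (polish_step_inv [:: X; X; Star; X; X; Star] _ _ _ _ _ Hq erefl).
  exact: (orbit7_cycle [:: X; X; Star; X; X; Star; Star; X; X; Star]).
(* Here [u_2 = x], [u_3 = xx*x*]: after [P] both words continue with [*xx*], then the expanded one
   with [cycle_star], the other with [cycle_x]. *)
- move=> Hq; rewrite (polish_step_inv _ _ _ _ _ _ Hq erefl).
  by have := orbit7_cycle_swap (P ++ [:: Star; X; X; Star]); rewrite -!catA.
- move=> Hq; rewrite (polish_step_inv_swap _ _ _ _ _ _ Hq erefl).
  by have := orbit7_cycle (P ++ [:: Star; X; X; Star]); rewrite -!catA.
Qed.

Theorem theorem5 :
  (forall u v : word, is_term u -> is_term v ->
     depth u <= 6 -> depth v <= 6 -> terminates u v) /\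
  (exists u v : word,
     is_term u /\ is_term v /\ depth u <= 7 /\ depth v <= 7 /\ diverges u v).
Proof.
split=> [u v Hu Hv du dv|].
  apply: (@halts_terminates 100 [::]) => //.
  by move/allP: halts_upto6 => /(_ u (mem_terms_upto _ _ Hu du)) /allP;
     apply; exact: mem_terms_upto.
have x := is_term_var; have xx := is_term_mul x x.
have xxx := is_term_mul xx x.
exists left7, right7; split.
  exact: is_term_mul xx (is_term_mul xx xxx).
split; first exact: is_term_mul x (is_term_mul xxx xxx).
by do !split=> //; exact: left7_right7_diverge.
Qed.
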